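(* If $f$ is a positive fertility number, then there exist a positive integer $n\leq f+1$ and a permutation $\pi\in S_n$ such that $f=|s^{-1}(\pi)|$.
   Context: A permutation is a permutation of a finite set of positive integers, written as a word in one-line notation (a word with distinct entries). $S_n$ denotes the set of permutations of $\{1,\ldots,n\}$. West's stack-sorting map $s$ is defined recursively: $s$ sends the empty permutation to the empty permutation, and if $\pi$ is a nonempty permutation with largest entry $m$, write $\pi=LmR$, where $L$ and $R$ are the (possibly empty) substrings of $\pi$ to the left and right of $m$; then $s(\pi)=s(L)s(R)m$. The fertility of a permutation $\pi$ is $|s^{-1}(\pi)|$, the number of preimages of $\pi$ under $s$. A nonnegative integer $f$ is a fertility number if there exists a permutation with fertility $f$. *)

(* Defs.v *)
From mathcomp Require Import all_boot.

Set Implicit Arguments.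
Unset Strict Implicit.
Unset Printing Implicit Defensive.

Definition is_permutation (p : seq nat) : bool :=
  uniq p && all (fun i => 0 < i) p.

Definition in_S (n : nat) (p : seq nat) : bool := perm_eq p (iota 1 n).

(* The first argument is a recursion bound; it is never exhausted when it is
   at least the length of the word. *)
Fixpoint stack_sort_rec (k : nat) (p : seq nat) : seq nat :=
  if k is k'.+1 then
    if p is [::] then [::] else
    let m := \max_(x <- p) x in
    let i := index m p in
    stack_sort_rec k' (take i p) ++ stack_sort_rec k' (drop i.+1 p) ++ [:: m]
  else [::].

(* West's map s, characterized by stack_sort_nil and stack_sort_max below. *)
Definition stack_sort (p : seq nat) : seq nat := stack_sort_rec (size p) p.

(* The list of preimages of p under s, without repetition. As s preserves the
   set of entries, it suffices to search the rearrangements of p; lemma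
   mem_preimages shows that no preimage is missed. *)
Definition preimages (p : seq nat) : seq (seq nat) :=
  [seq t <- permutations p | stack_sort t == p].

Definition fertility (p : seq nat) : nat := size (preimages p).

Definition fertility_number (f : nat) : Prop :=
  exists2 p : seq nat, is_permutation p & fertility p = f.

Lemma max_mem (p : seq nat) : p != [::] -> \max_(x <- p) x \in p.
Proof.
elim: p => // a p IHp _; rewrite big_cons in_cons.
case: (eqVneq p [::]) => [->|/IHp pm]; first by rewrite big_nil maxn0 eqxx.
by rewrite /maxn; case: ifP; rewrite ?pm ?orbT ?eqxx.
Qed.

Lemma stack_sort_rec_size (k : nat) (p : seq nat) :
  size p <= k -> stack_sort_rec k p = stack_sort p.
Proof.
suff H : forall j k' q, size q <= j -> size q <= k' ->
    stack_sort_rec j q = stack_sort_rec k' q.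
  by move=> pk; apply: H.
elim=> [|j IHj] [|k'] [|a q] //=; rewrite !ltnS => qj qk.
set p' := a :: q; set m := \max_(x <- p') x.
have mp : m \in p' by exact: max_mem.
have ip : index m p' <= size q by rewrite -ltnS -[(size q).+1]/(size p') index_mem.
have st : size (take (index m p') p') <= size q.
  by rewrite size_take -[size p']/(size q).+1 ltnS ip.
have sd : size (drop (index m p') q) <= size q by rewrite size_drop leq_subr.
by congr (_ ++ (_ ++ _)); apply: IHj; apply: leq_trans; eassumption.
Qed.

Lemma stack_sort_nil : stack_sort [::] = [::].
Proof. by []. Qed.

Lemma stack_sort_max (L R : seq nat) (m : nat) :
  all (fun x => x < m) (L ++ R) ->
  stack_sort (L ++ m :: R) = stack_sort L ++ stack_sort R ++ [:: m].
Proof.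
rewrite all_cat => /andP[/allP Lm /allP Rm].
have mE : \max_(x <- L ++ m :: R) x = m.
  apply/eqP; rewrite eqn_leq; apply/andP; split.
    apply/bigmax_leqP_seq => x; rewrite mem_cat in_cons => xLR _.
    by case/or3P: xLR => [/Lm/ltnW|/eqP->|/Rm/ltnW].
  by apply: (leq_bigmax_seq (F := fun x => x)); rewrite ?mem_cat ?mem_head ?orbT.
have iE : index m (L ++ m :: R) = size L.
  by rewrite index_cat /= eqxx addn0; case: ifP => // /Lm; rewrite ltnn.
rewrite {1}/stack_sort size_cat /= addnS.
have E k p : p != [::] -> stack_sort_rec k.+1 p =
    (let m := \max_(x <- p) x in let i := index m p in
     stack_sort_rec k (take i p) ++ stack_sort_rec k (drop i.+1 p) ++ [:: m]).
  by case: p.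
rewrite E; last by case: (L).
have dE : drop (size L).+1 (L ++ m :: R) = R.
  by rewrite -cat_rcons drop_size_cat // size_rcons.
by rewrite mE /= iE take_size_cat // dE !stack_sort_rec_size ?leq_addr ?leq_addl.
Qed.

Lemma perm_stack_sort (p : seq nat) : perm_eq (stack_sort p) p.
Proof.
rewrite /stack_sort; move: (leqnn (size p)); move: {2 3}(size p) => k.
elim: k p => [|k IHk] [|a q] // qk; rewrite [stack_sort_rec _ _]/=.
set p := a :: q in qk *; set m := \max_(x <- p) x.
have mp : m \in p by exact: max_mem.
have ip : index m p < size p by rewrite index_mem.
set l := take _ _; set r := drop _ _.
have pE : p = l ++ m :: r.
  rewrite -{1}(cat_take_drop (index m p) p); congr (_ ++ _).
  by rewrite (drop_nth 0) // nth_index.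
have lrk : size l + size r <= k.
  by move: qk; rewrite pE size_cat /= addnS ltnS.
rewrite pE perm_sym perm_catC /= perm_sym catA perm_catC /= perm_cons.
rewrite perm_sym perm_catC perm_sym; apply: perm_cat; apply: IHk.
  exact: leq_trans (leq_addr _ _) lrk.
exact: leq_trans (leq_addl _ _) lrk.
Qed.

Lemma preimages_uniq (p : seq nat) : uniq (preimages p).
Proof. by rewrite filter_uniq ?permutations_uniq. Qed.

Lemma mem_preimages (p t : seq nat) : is_permutation p ->
  (t \in preimages p) = is_permutation t && (stack_sort t == p).
Proof.
move=> pP; rewrite mem_filter mem_permutations andbC.
case: eqP => [tp|_]; rewrite ?andbF // !andbT.
have tpE : perm_eq t p by rewrite -tp perm_sym perm_stack_sort.
by rewrite tpE /is_permutation (perm_uniq tpE) (perm_all _ tpE); apply/esym.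
Qed.

(* Main.v *)
Require Import Defs.
From mathcomp Require Import all_boot zify.

Set Implicit Arguments.
Unset Strict Implicit.
Unset Printing Implicit Defensive.

(** A word u is treated through its decreasing binary tree: the root is the
    maximum d of u = A d B, and the subtrees are the trees of A and of B.  Let
    F_u(x) be the generating function whose coefficient of x^n is the fertility
    of u followed by n larger increasing entries.  Only the shape of the tree
    matters for F_u:

    - F = C, the Catalan series, for the empty word;
    - F_(A d) = (F_A - F_A(0)) / x, since d is one more large entry after A;
    - F_(A d B) = (F_A - F_A(0)) F_B for B nonempty: a preimage under s of a
      word w amounts to a decreasing binary tree with postorder w; there d, being
      followed by a smaller entry, is the left child of a large entry t.  The
      entries between d and t form the right subtree of t, a preimage of B
      followed by large entries; in the rest of the tree, d takes the place of t
      and is one of the large entries following A.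

    These rules define [series] on trees.  [word_series_split] checks them
    against the recurrence [fertility_rcons] for the fertility, and
    [fertility_series] concludes that the fertility of u is the constant term of
    F_u.  As every binary tree with n nodes is the shape of some element of S_n
    ([fertility_tree_word]), it remains to find, for a tree t with constant term
    f > 0, a nonempty tree with the same constant term and at most f + 1 nodes.

    The constant term is a sum, over certain tuples (q_i) indexed by the s empty
    left ends of the tree (one per maximal chain of left edges), of the products
    of the Catalan numbers C_(q_i), where every q_i >= 1 as t is nonempty.  If t
    has r nodes without a right child, then sum q_i = r, and t has r + s - 1 nodes.

    If some q_i equals 1 in all the tuples, then the Catalan series at that
    position may be replaced by x.  The recursion then simplifies, and
    [contract] exhibits a tree with two nodes fewer and the same constant term
    (or t has a single node).  So a tree of minimal size may be assumed to have,
    for each i, a tuple with q_i >= 2.  Put e = r - s.  Each product is at least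
    2^e because C_q >= 2^(q-1), so each i accounts for tuples of total weight at
    least 2^e; and a tuple has at most e entries that are at least 2.  Hence
    s 2^e <= e f, which forces 2 s + e - 1 <= f + 1 ([size_bound]). *)

(** * Convolution of sequences *)

(** A sequence stands for its generating function: [conv] is the product,
    [delta0] is the series 1, and [shift] is the multiplication by x. *)
Definition conv (f g : nat -> nat) (n : nat) : nat :=
  \sum_(i < n.+1) f i * g (n - i).

Definition trunc (f : nat -> nat) (n : nat) : nat := if n is 0 then 0 else f n.

Definition delta0 (n : nat) : nat := n == 0.

Definition shift (f : nat -> nat) (n : nat) : nat :=
  if n is m.+1 then f m else 0.

Lemma eq_conv f f' g g' : f =1 f' -> g =1 g' -> conv f g =1 conv f' g'.
Proof. by move=> ff gg n; apply: eq_bigr => i _; rewrite ff gg. Qed.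

Lemma eq_trunc f f' : f =1 f' -> trunc f =1 trunc f'.
Proof. by move=> ff [|n] /=. Qed.

Lemma eq_shift f f' : f =1 f' -> shift f =1 shift f'.
Proof. by move=> ff [|n] /=. Qed.

Lemma shift_succ f : shift (fun n => f n.+1) =1 trunc f.
Proof. by case. Qed.

Lemma trunc_shift f : trunc (shift f) =1 shift f.
Proof. by case. Qed.

Lemma trunc_id f : f 0 = 0 -> trunc f =1 f.
Proof. by move=> f0 [|n]. Qed.

Lemma conv_shiftl f g : conv (shift f) g =1 shift (conv f g).
Proof.
case=> [|n]; first by rewrite /conv big_ord1.
by rewrite /conv big_ord_recl /= add0n; apply: eq_bigr.
Qed.

Lemma conv_shiftr f g : conv f (shift g) =1 shift (conv f g).
Proof.
case=> [|n]; first by rewrite /conv big_ord1 muln0.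
rewrite /conv big_ord_recr /= subnn muln0 addn0; apply: eq_bigr => i _.
by rewrite subSn // -ltnS.
Qed.

Lemma conv_trunc_0 f g : conv (trunc f) g 0 = 0.
Proof. by rewrite /conv big_ord1. Qed.

Lemma conv_trunc f g n : conv f g n = f 0 * g n + conv (trunc f) g n.
Proof. by rewrite /conv big_ord_recl [in RHS]big_ord_recl subn0. Qed.

Lemma conv_truncS f g n : conv (trunc f) g n.+1 = conv (fun m => f m.+1) g n.
Proof. by rewrite /conv big_ord_recl /= add0n; apply: eq_bigr. Qed.

Lemma conv_delta0 f : conv f delta0 =1 f.
Proof.
move=> n; rewrite /conv big_ord_recr /= subnn muln1 big1 ?add0n // => i _.
by rewrite /delta0 subn_eq0 leqNgt ltn_ord muln0.
Qed.

Lemma delta0_conv f : conv delta0 f =1 f.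
Proof. by move=> n; rewrite /conv big_ord_recl /= mul1n subn0 big1 ?addn0. Qed.

Lemma conv_0l f g : f =1 (fun=> 0) -> conv f g =1 (fun=> 0).
Proof. by move=> f0 n; apply: big1 => i _; rewrite f0. Qed.

Lemma conv_0r f g : g =1 (fun=> 0) -> conv f g =1 (fun=> 0).
Proof. by move=> g0 n; apply: big1 => i _; rewrite g0 muln0. Qed.

Lemma convDl f f' g n :
  conv (fun m => f m + f' m) g n = conv f g n + conv f' g n.
Proof. by rewrite -big_split; apply: eq_bigr => i _; rewrite mulnDl. Qed.

Lemma convDr f g g' n :
  conv f (fun m => g m + g' m) n = conv f g n + conv f g' n.
Proof. by rewrite -big_split; apply: eq_bigr => i _; rewrite mulnDr. Qed.

Lemma conv_suml k (F : nat -> nat -> nat) g n :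
  conv (fun m => \sum_(i < k) F i m) g n = \sum_(i < k) conv (F i) g n.
Proof. by rewrite exchange_big; apply: eq_bigr => i _; rewrite big_distrl. Qed.

Lemma conv_sumr k f (F : nat -> nat -> nat) n :
  conv f (fun m => \sum_(i < k) F i m) n = \sum_(i < k) conv f (F i) n.
Proof. by rewrite exchange_big; apply: eq_bigr => i _; rewrite big_distrr. Qed.

Lemma conv_scalel c f g n : conv (fun m => c * f m) g n = c * conv f g n.
Proof. by rewrite big_distrr; apply: eq_bigr => i _; rewrite /= mulnA. Qed.

Lemma convC f g : conv f g =1 conv g f.
Proof.
move=> n; rewrite /conv (reindex_inj rev_ord_inj); apply: eq_bigr => i _ /=.
by rewrite mulnC subSS subKn // -ltnS ltn_ord.
Qed.

(** By induction on n, using f = f 0 + x * (tail of f). *)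
Lemma convA f g h : conv (conv f g) h =1 conv f (conv g h).
Proof.
move=> n; elim: n f => [|n IHn] f.
  by rewrite /conv !big_ord1 /= mulnA.
have convS f1 g1 k :
    conv f1 g1 k.+1 = f1 0 * g1 k.+1 + conv (fun m => f1 m.+1) g1 k.
  by rewrite /conv big_ord_recl subn0; congr (_ + _); apply: eq_bigr.
rewrite convS [RHS]convS -IHn (eq_conv (convS f g) (frefl h)).
rewrite convDl conv_scalel.
rewrite [conv g h _]convS /conv !big_ord1 addnA; congr (_ + _).
by rewrite mulnDr mulnA.
Qed.

(** * Catalan numbers *)

(** The first argument is a recursion bound, harmless once it is at least n. *)
Fixpoint catalan_rec (k n : nat) : nat :=
  if (k, n) is (k'.+1, n'.+1)
  then conv (catalan_rec k') (catalan_rec k') n' else 1.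

Definition catalan (n : nat) : nat := catalan_rec n n.

Lemma catalan_rec_bound k n : n <= k -> catalan_rec k n = catalan n.
Proof.
have H j : forall k' m, m <= j -> m <= k' -> catalan_rec j m = catalan_rec k' m.
  elim: j => [|j IHj] [|k'] [|m] //=; rewrite !ltnS => mj mk.
  by apply: eq_bigr => i _; congr (_ * _); apply: IHj; have := ltn_ord i; lia.
by move=> nk; apply: H.
Qed.

Lemma catalanS n : catalan n.+1 = conv catalan catalan n.
Proof.
rewrite {1}/catalan /= /conv; apply: eq_bigr => i _.
by rewrite !catalan_rec_bound ?leq_subr // -ltnS.
Qed.

Lemma catalan1 : catalan 1 = 1.
Proof. by rewrite catalanS /conv big_ord1. Qed.

(** The two extreme terms of the convolution already give C_(n+1) >= 2 C_n for
    n >= 1. *)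
Lemma leq_exp2_catalan n : 2 ^ n <= 2 * catalan n.
Proof.
case: n => // n; rewrite expnS leq_pmul2l //; elim: n => [|n IHn].
  by rewrite catalan1.
rewrite catalanS /conv big_ord_recl big_ord_recr /= subn0 subnn.
rewrite /bump /= add1n (_ : catalan 0 = 1) // mul1n muln1 expnS; lia.
Qed.

(** * Series of a binary tree *)

Inductive tree := Leaf | Node of tree & tree.

Fixpoint tree_size (t : tree) : nat :=
  if t is Node a b then (tree_size a + tree_size b).+1 else 0.

(** The coefficients of F_u for any word u of shape t with distinct entries.  A node
    whose right subtree is empty behaves differently from the general rule: its
    label only adds one entry to the increasing end of the word. *)
Fixpoint series (t : tree) (n : nat) : nat :=
  match t with
  | Leaf => catalan n
  | Node a Leaf => series a n.+1
  | Node a b => conv (trunc (series a)) (series b) n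
  end.

Lemma LeafVnode t : t = Leaf \/ t <> Leaf.
Proof. by case: t; [left | right]. Qed.

Lemma seriesN a b : b <> Leaf ->
  series (Node a b) =1 conv (trunc (series a)) (series b).
Proof. by case: b. Qed.

(** * Fertility as a coefficient *)

(** The decreasing binary tree of a word, without its labels.  The first
    argument is a recursion bound. *)
Fixpoint shape_rec (k : nat) (p : seq nat) : tree :=
  if k is k'.+1 then
    if p is [::] then Leaf else
    let i := index (\max_(x <- p) x) p in
    Node (shape_rec k' (take i p)) (shape_rec k' (drop i.+1 p))
  else Leaf.

Definition shape (p : seq nat) : tree := shape_rec (size p) p.

Lemma index_max (A B : seq nat) (d : nat) : all (fun x => x < d) (A ++ B) ->
  index (\max_(x <- A ++ d :: B) x) (A ++ d :: B) = size A.
Proof.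
rewrite all_cat => /andP[/allP Ad /allP Bd].
have -> : \max_(x <- A ++ d :: B) x = d.
  apply/eqP; rewrite eqn_leq; apply/andP; split.
    apply/bigmax_leqP_seq => x; rewrite mem_cat in_cons => xAB _.
    by case/or3P: xAB => [/Ad/ltnW|/eqP->|/Bd/ltnW].
  by apply: (leq_bigmax_seq (F := id)); rewrite ?mem_cat ?mem_head ?orbT.
by rewrite index_cat /= eqxx addn0; case: ifP => // /Ad; rewrite ltnn.
Qed.

Lemma shape_rec_bound k p : size p <= k -> shape_rec k p = shape p.
Proof.
have H j : forall k' q, size q <= j -> size q <= k' ->
    shape_rec j q = shape_rec k' q.
  elim: j => [|j IHj] [|k'] [|a q] //=; rewrite !ltnS => qj qk.
  set p' := a :: q; pose i := index (\max_(x <- p') x) p'.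
  have ip : i <= size q.
    by rewrite -ltnS -[(size q).+1]/(size p') index_mem max_mem.
  have st : size (take i p') <= size q.
    by rewrite size_take -[size p']/(size q).+1 ltnS ip.
  have sd : size (drop i q) <= size q by rewrite size_drop leq_subr.
  by congr (Node _ _); apply: IHj; apply: leq_trans; eassumption.
by move=> pk; apply: H.
Qed.

Lemma shape_max A B d : all (fun x => x < d) (A ++ B) ->
  shape (A ++ d :: B) = Node (shape A) (shape B).
Proof.
move=> ABd; rewrite {1}/shape size_cat /= addnS.
have E k p : p != [::] -> shape_rec k.+1 p =
    let i := index (\max_(x <- p) x) p in
    Node (shape_rec k (take i p)) (shape_rec k (drop i.+1 p)) by case: p.
rewrite E; last by case: (A).
rewrite /= index_max // take_size_cat //.
rewrite -cat_rcons drop_size_cat ?size_rcons //.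
by rewrite !shape_rec_bound ?leq_addr ?leq_addl.
Qed.

Lemma shape_Leaf p : shape p = Leaf -> p = [::].
Proof. by case: p. Qed.

Definition word_series (p : seq nat) : nat -> nat := series (shape p).

Lemma word_series_rcons A d : all (fun x => x < d) A ->
  word_series (rcons A d) =1 (fun n => word_series A n.+1).
Proof. by move=> Ad n; rewrite /word_series -cats1 shape_max // cats0. Qed.

Lemma word_series_max A B d : B <> [::] -> all (fun x => x < d) (A ++ B) ->
  word_series (A ++ d :: B) =1 conv (trunc (word_series A)) (word_series B).
Proof.
by move=> B0 ABd n; rewrite /word_series shape_max // seriesN // => /shape_Leaf.
Qed.

Lemma split_max (p : seq nat) : uniq p -> p != [::] ->
  exists A d B, p = A ++ d :: B /\ all (fun x => x < d) (A ++ B).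
Proof.
move=> Up p0; have mp := max_mem p0; move: mp Up.
set m := \max_(x <- p) x => mp Up.
case/splitPr: {-1}p / mp (erefl p) => A B pE.
exists A, m, B; split=> //; apply/allP => x xAB.
have xp : x \in p.
  by move: xAB; rewrite pE !mem_cat inE => /orP[] ->; rewrite ?orbT.
have xm : x <= m by apply: (leq_bigmax_seq (F := id)).
rewrite ltn_neqAle xm andbT; apply: contraTneq xAB => ->.
by move: Up; rewrite pE -cat1s uniq_catCA /= => /andP[].
Qed.

Lemma sum_cuts_cat (h : seq nat -> seq nat -> nat) (x y : seq nat) :
  \sum_(i < size (x ++ y)) h (take i (x ++ y)) (drop i (x ++ y)) =
  \sum_(i < size x) h (take i x) (drop i x ++ y) +
  \sum_(i < size y) h (x ++ take i y) (drop i y).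
Proof.
rewrite size_cat big_split_ord /=; congr (_ + _); apply: eq_bigr => i _.
  by rewrite drop_cat ltn_ord takel_cat // ltnW.
by rewrite takeD addnC -drop_drop take_size_cat ?drop_size_cat.
Qed.

(** This is the recurrence that [fertility_rcons] gives for the word u followed
    by n + 1 large entries, the last one being the maximum: a cut either falls
    inside u, or leaves u and i large entries on its left and n - i increasing
    entries on its right.  For u = A d B with B nonempty, the cuts inside A and
    those after A d B come from the recurrence for A, the cut after d gives the
    only additional term, and the cuts inside B give 0, because their left part
    does not end with its maximum d. *)
Lemma word_series_split (u : seq nat) (n : nat) : uniq u ->
  word_series u n.+1 =
    \sum_(i < size u) word_series (take i u) 0 * word_series (drop i u) n +
    conv (word_series u) catalan n.
Proof.
elim: {u}(size u) {-2}u (leqnn (size u)) n => [|N IHN] u.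
  by rewrite leqn0 size_eq0 => /eqP-> n _; rewrite big_ord0; apply: catalanS.
move=> uN n Uu; have [->|u0] := eqVneq u [::].
  by rewrite big_ord0; apply: catalanS.
have [A [d [B [uE ABd]]]] := split_max Uu u0; rewrite {}uE in uN Uu *.
move: (Uu); rewrite cat_uniq => /and3P[UA _ /andP[_ UB]].
have AN : size A <= N by move: uN; rewrite size_cat /=; lia.
move: (ABd); rewrite all_cat => /andP[Ad Bd].
have dropAd i : all (fun x => x < d) (drop i A).
  by apply/allP => x /mem_drop; apply: (allP Ad).
have [B0|B0] := eqVneq B [::].
  rewrite {}B0 cats1 {ABd uN Uu}.
  rewrite word_series_rcons // IHN // -cats1.
  rewrite (sum_cuts_cat (fun x y => word_series x 0 * word_series y n)).
  rewrite big_ord1 /= cats0 -addnA; congr (_ + _).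
    apply: eq_bigr => i _; rewrite cats1.
    by rewrite word_series_rcons.
  rewrite [LHS]/conv big_ord_recl subn0; congr (_ * _ + _).
  by apply: eq_bigr => i _; rewrite cats1 word_series_rcons.
have {B0} B0 : B <> [::] by apply/eqP.
rewrite (sum_cuts_cat (fun x y => word_series x 0 * word_series y n)).
have wE : word_series (A ++ d :: B) =1
    conv (trunc (word_series A)) (word_series B).
  exact: word_series_max.
(* The constant term is dropped: the coefficient of x in the series of A is the
   contribution of the cut after d, and is not to be expanded. *)
have tailE : trunc (fun m => word_series A m.+1) =1 (fun m =>
    \sum_(i < size A)
       word_series (take i A) 0 * trunc (word_series (drop i A)) m
    + (word_series A 0 * trunc catalan m +
       conv (trunc (word_series A)) catalan m)).
  case=> [|m] /=.
    by rewrite conv_trunc_0 muln0 big1 // => i _; rewrite muln0.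
  by rewrite IHN // conv_trunc.
have -> : word_series (A ++ d :: B) n.+1 = word_series A 1 * word_series B n +
    conv (trunc (fun m => word_series A m.+1)) (word_series B) n.
  by rewrite wE conv_truncS conv_trunc.
pose F i m := word_series (take i A) 0 * trunc (word_series (drop i A)) m.
rewrite (eq_conv tailE (frefl _)) convDl (conv_suml (size A) F).
rewrite convDl conv_scalel.
rewrite [size (d :: B)]/= big_ord_recl /= cats0.
case: B B0 => // b B _ in Uu uN ABd UB Bd wE F tailE *.
rewrite big_ord_recl /= cats1 word_series_rcons //.
rewrite [\sum_(i < size B) _]big1 ?addn0 => [|i _]; last first.
  rewrite word_series_max ?conv_trunc_0 //.
  apply/allP => x xAB; apply: (allP ABd); move: xAB; rewrite !mem_cat.
  by case/orP => [->//|/(@mem_take i.+1 _ (b :: B)) ->]; rewrite orbT.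
have -> : word_series (d :: b :: B) n =
    conv (trunc catalan) (word_series (b :: B)) n.
  exact: (@word_series_max [::]).
rewrite (eq_conv wE (frefl _)) convA (eq_conv (frefl _) (convC _ _)) -convA.
rewrite addnCA -!addnA; congr (_ + _); last by rewrite addnCA.
apply: eq_bigr => i _; rewrite word_series_max ?all_cat ?dropAd //.
by rewrite conv_scalel.
Qed.

(** This holds for every word p, as s only rearranges its argument. *)
Lemma mem_preimages_eq p t : (t \in preimages p) = (stack_sort t == p).
Proof.
rewrite mem_filter mem_permutations; case: eqP => //= <-.
by rewrite perm_sym perm_stack_sort.
Qed.

Lemma cat_cons_inj (L L' R R' : seq nat) (m : nat) :
  m \notin L -> m \notin L' ->
  L ++ m :: R = L' ++ m :: R' -> L = L' /\ R = R'.
Proof.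
move=> mL mL' E; have /eqP : L = L'.
  have := congr1 (fun s => take (index m s) s) E.
  by rewrite /= !index_cat (negPf mL) (negPf mL') /= eqxx !addn0 !take_size_cat.
move/eqP=> LL; split=> //; move/eqP: E.
by rewrite LL eqseq_cat // => /andP[_ /eqP[]].
Qed.

Lemma perm_max_split t w m : all (fun x => x < m) w -> perm_eq t (rcons w m) ->
  exists L R, t = L ++ m :: R /\ all (fun x => x < m) (L ++ R).
Proof.
move=> wm tw; have mt : m \in t by rewrite (perm_mem tw) mem_rcons mem_head.
case/splitPr: t / mt tw => L R tw; exists L, R; split=> //.
have LRw : perm_eq (L ++ R) w.
  move: tw; rewrite -cat1s perm_catCA perm_sym perm_rcons perm_cons.
  by rewrite perm_sym.
by rewrite (perm_all _ LRw).
Qed.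

(** A preimage of w m is L m R with s(L) s(R) = w, so it amounts to a cut of w
    together with a preimage of each part. *)
Lemma fertility_rcons w m : all (fun x => x < m) w ->
  fertility (rcons w m) =
    \sum_(i < (size w).+1) fertility (take i w) * fertility (drop i w).
Proof.
move=> wm; set P := preimages (rcons w m).
have idxP t : t \in P -> index m t < (size w).+1.
  rewrite mem_preimages_eq => /eqP tE.
  have tw : perm_eq t (rcons w m) by rewrite -tE perm_sym perm_stack_sort.
  rewrite -(size_rcons w m) -(perm_size tw) index_mem (perm_mem tw).
  by rewrite mem_rcons mem_head.
(* Classify the preimages by the position of m. *)
have -> : fertility (rcons w m) =
    \sum_(i < (size w).+1) count (fun t => index m t == i) P.
  rewrite -[LHS]sum1_size -/P big_seq.
  under [RHS]eq_bigr do rewrite -sum1_count big_mkcond big_seq.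
  rewrite exchange_big; apply: eq_bigr => t /idxP it /=.
  rewrite (bigD1 (Ordinal it)) //= eqxx big1 // => i /negPf iN.
  by rewrite (_ : _ == _ = false) // -iN -val_eqE eq_sym.
apply: eq_bigr => -[/= i iw] _; rewrite -size_filter.
rewrite -(size_allpairs (fun L R => L ++ m :: R)).
have notin s j : s \in preimages (take j w) -> m \notin s.
  rewrite mem_preimages_eq => /eqP sE; apply/negP.
  rewrite -(perm_mem (perm_stack_sort s)) sE => /mem_take /(allP wm).
  by rewrite ltnn.
apply: perm_size; apply: uniq_perm; first exact/filter_uniq/preimages_uniq.
  apply: allpairs_uniq; rewrite ?preimages_uniq // => -[L R] [L' R'].
  case/allpairsP=> -[? ?] [/= /notin mL _ [-> ->]].
  case/allpairsP=> -[? ?] [/= /notin mL' _ [-> ->]].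
  by case/(cat_cons_inj mL mL') => -> ->.
move=> t; rewrite mem_filter mem_preimages_eq; apply/andP/allpairsP.
  case=> /eqP ti /eqP tE.
  have [|L [R [tLR LRm]]] := @perm_max_split t w m wm.
    by rewrite -tE perm_sym perm_stack_sort.
  have mL : m \notin L.
    apply/negP => mL; move: LRm; rewrite all_cat => /andP[/allP/(_ _ mL)].
    by rewrite ltnn.
  have sL : size L = i by rewrite -ti tLR index_cat (negPf mL) /= eqxx addn0.
  move: tE; rewrite tLR stack_sort_max // catA cats1 => /rcons_inj[wE].
  exists (L, R); rewrite /= !mem_preimages_eq.
  have sL' : size (stack_sort L) = i by rewrite (perm_size (perm_stack_sort L)).
  have -> : take i w = stack_sort L by rewrite -wE take_size_cat.
  by have -> : drop i w = stack_sort R by rewrite -wE drop_size_cat.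
case=> -[L R] [/= Li Ri ->]; have mL := notin _ _ Li.
rewrite mem_preimages_eq in Li; rewrite mem_preimages_eq in Ri.
have sL : size L = i.
  rewrite -(perm_size (perm_stack_sort L)) (eqP Li) size_take.
  by move: iw; rewrite ltnS leq_eqVlt => /orP[/eqP->|->] //; rewrite ltnn.
rewrite index_cat (negPf mL) /= eqxx addn0 sL eqxx; split=> //.
rewrite stack_sort_max; last first.
  rewrite -(perm_all _ (perm_cat (perm_stack_sort L) (perm_stack_sort R))).
  by rewrite (eqP Li) (eqP Ri) cat_take_drop.
by rewrite (eqP Li) (eqP Ri) catA cat_take_drop cats1.
Qed.

(** Images under s end with their maximum. *)
Lemma fertility_not_max A B d : B <> [::] -> all (fun x => x < d) (A ++ B) ->
  fertility (A ++ d :: B) = 0.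
Proof.
move=> B0 ABd; rewrite /fertility; apply/eqP; rewrite size_eq0.
case P: (preimages _) => [//|t s]; exfalso.
have : t \in preimages (A ++ d :: B) by rewrite P mem_head.
rewrite mem_preimages_eq => /eqP tE.
have [|L [R [tLR LRm]]] := @perm_max_split t (A ++ B) d ABd.
  apply: (@perm_trans _ (A ++ d :: B)).
    by rewrite -tE perm_sym perm_stack_sort.
  by rewrite perm_sym perm_rcons -(cat1s d B) -cat1s perm_catCA perm_refl.
move: tE; rewrite tLR stack_sort_max // catA cats1.
case/lastP: B B0 ABd {P} => // B b _ + E.
rewrite -rcons_cons -rcons_cat in E; case/rcons_inj: E => _ <-.
by rewrite -rcons_cat all_rcons ltnn.
Qed.

Lemma fertility_series (u : seq nat) : uniq u -> fertility u = word_series u 0.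
Proof.
elim: {u}(size u) {-2}u (leqnn (size u)) => [|N IHN] u.
  by rewrite leqn0 size_eq0 => /eqP->.
move=> uN Uu; have [->//|u0] := eqVneq u [::].
have [A [d [B [uE ABd]]]] := split_max Uu u0; rewrite {}uE in uN Uu *.
have [B0|/eqP B0] := eqVneq B [::]; last first.
  by rewrite fertility_not_max // word_series_max // conv_trunc_0.
rewrite {}B0 cats0 cats1 in uN Uu ABd *.
move: uN Uu; rewrite size_rcons ltnS rcons_uniq => AN /andP[_ UA].
rewrite fertility_rcons // word_series_rcons // word_series_split //.
rewrite /conv big_ord1 big_ord_recr take_size drop_size /= !IHN //.
congr (_ + _); apply: eq_bigr => i _.
rewrite !IHN ?take_uniq ?drop_uniq //.
  by rewrite size_drop; apply: leq_trans (leq_subr _ _) AN.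
by apply: leq_trans AN; rewrite size_take; case: ifP => // /ltnW.
Qed.

(** * Every tree is the shape of a permutation *)

(** The labels of t are o + 1, ..., o + n.  The root carries the largest, and
    all the labels of the left subtree are below those of the right one. *)
Fixpoint tree_word (o : nat) (t : tree) : seq nat :=
  if t is Node a b then
    tree_word o a ++ o + tree_size t :: tree_word (o + tree_size a) b
  else [::].

Lemma perm_tree_word o t : perm_eq (tree_word o t) (iota o.+1 (tree_size t)).
Proof.
elim: t o => //= a IHa b IHb o.
rewrite -[_ :: iota _ _]/(iota o.+1 (_ + _).+1) -[X in iota _ X]addn1 2!iotaD.
rewrite -cat1s perm_catCA perm_sym perm_catC addSnnS perm_cons.
by rewrite perm_sym perm_cat.
Qed.

Lemma shape_tree_word o t : shape (tree_word o t) = t.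
Proof.
elim: t o => //= a IHa b IHb o; rewrite shape_max ?IHa ?IHb //.
apply/allP => x; rewrite mem_cat !(perm_mem (perm_tree_word _ _)).
rewrite !mem_iota; lia.
Qed.

Lemma fertility_tree_word t : fertility (tree_word 0 t) = series t 0.
Proof.
rewrite fertility_series /word_series ?shape_tree_word //.
by rewrite (perm_uniq (perm_tree_word 0 t)) iota_uniq.
Qed.

(** * Trees with a forced exponent *)

(** The number of maximal chains of left edges, each ending in an empty subtree
    that contributes a Catalan series. *)
Fixpoint spines (t : tree) : nat :=
  match t with
  | Leaf => 1
  | Node a Leaf => spines a
  | Node a b => spines a + spines b
  end.

Fixpoint rightless (t : tree) : nat :=
  match t with
  | Leaf => 0
  | Node a Leaf => (rightless a).+1
  | Node a b => rightless a + rightless b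
  end.

(** The series of t in which the Catalan series of the i-th chain, from left to
    right, is replaced by w. *)
Fixpoint series_at (w : nat -> nat) (t : tree) (i n : nat) : nat :=
  match t with
  | Leaf => w n
  | Node a Leaf => series_at w a i n.+1
  | Node a b =>
      if i < spines a then conv (trunc (series_at w a i)) (series b) n
      else conv (trunc (series a)) (series_at w b (i - spines a)) n
  end.

(** The Catalan series is the sum of [delta1] and [catalan_ge2] up to its
    constant term, which [series_at_split] shows to be irrelevant. *)
Definition delta1 (n : nat) : nat := n == 1.
Definition catalan_ge2 (n : nat) : nat := if 1 < n then catalan n else 0.

Lemma spines_gt0 t : 0 < spines t.
Proof. by elim: t => //= a IHa [|b1 b2] IHb //; rewrite addn_gt0 IHa. Qed.

Lemma spinesN a b : b <> Leaf -> spines (Node a b) = spines a + spines b.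
Proof. by case: b. Qed.

Lemma rightlessN a b : b <> Leaf ->
  rightless (Node a b) = rightless a + rightless b.
Proof. by case: b. Qed.

Lemma series_atN w a b i : b <> Leaf ->
  series_at w (Node a b) i =1
    if i < spines a then conv (trunc (series_at w a i)) (series b)
    else conv (trunc (series a)) (series_at w b (i - spines a)).
Proof. by case: b => //= *; case: ifP. Qed.

Lemma tree_sizeE t : (tree_size t).+1 = rightless t + spines t.
Proof.
elim: t => //= a IHa [|b1 b2] IHb; first by rewrite addn0 addSn -IHa.
by rewrite addnACA -IHa -IHb addSn addnS.
Qed.

(** The possible effects of replacing a Catalan series by x in t, where f is the
    resulting series.  The power of x times the series of a smaller tree in
    [ContractShift] makes up for one of the two nodes to be removed: cancelling
    it against a division by x removes the node responsible for the division,
    and leads to [ContractSame]. *)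
Variant contraction (t : tree) (f : nat -> nat) : Prop :=
| ContractLeaf of t = Leaf
| ContractOne of tree_size t = 1 & f =1 delta0
| ContractZero of f =1 (fun=> 0)
| ContractSame t' of t' <> Leaf & tree_size t = (tree_size t').+2
    & f =1 series t'
| ContractShift t' of t' <> Leaf & tree_size t = (tree_size t').+1
    & f =1 shift (series t').

(** By induction along the path from the marked leaf to the root.  The factor x
    appears at a node (x, B), whose series is x F_B, or at a node (A, D) where D
    is the single node that has become 1: its series is F_A - F_A(0), that is, x
    times the series of the node (A, empty).  A factor x passes through every
    node until a division by x cancels it. *)
Lemma contract t i : contraction t (series_at delta1 t i).
Proof.
elim: t i => [|a IHa b IHb] i; first exact: ContractLeaf.
have [bL|bL] := LeafVnode b.
  subst b => {IHb}; case: (IHa i) => [aL|a1 aE|aE|a' a'L sz aE|a' a'L sz aE] /=.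
  - by subst a; apply: ContractOne.
  - by apply: ContractZero => n; rewrite aE.
  - by apply: ContractZero => n; rewrite aE.
  - by apply: (@ContractSame _ _ (Node a' Leaf)) => [||n] //=;
       rewrite ?sz // aE.
  - by apply: (@ContractSame _ _ a') => [||n] //=; rewrite ?aE // sz addn0.
have -> : series_at delta1 (Node a b) i =
    if i < spines a then conv (trunc (series_at delta1 a i)) (series b)
    else conv (trunc (series a)) (series_at delta1 b (i - spines a)).
  by case: (b) bL => //= *; case: ifP.
case: ifP => _.
  case: (IHa i) => [aL|a1 aE|aE|a' a'L sz aE|a' a'L sz aE].
  - subst a; apply: (@ContractShift _ _ b) => // n.
    rewrite -[RHS](eq_shift (delta0_conv (series b))) -conv_shiftl.
    by apply: eq_conv => // -[|[|m]].
  - by apply: ContractZero; apply: conv_0l => n; rewrite (eq_trunc aE); case: n.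
  - by apply: ContractZero; apply: conv_0l => n; rewrite (eq_trunc aE); case: n.
  - apply: (@ContractSame _ _ (Node a' b)) => [//||n]; first by rewrite /= sz.
    by rewrite seriesN //; apply: eq_conv => //; apply: eq_trunc.
  (* The left factor x F_a' needs no truncation, while F_a' would be truncated
     in a tree with left subtree a'.  If the root of a' has a right child,
     F_a' has no constant term; otherwise x F_a' is the truncation of F_g. *)
  case: a' a'L sz aE => // g c _ sz aE.
  have E n : conv (trunc (series_at delta1 a i)) (series b) n =
      conv (shift (series (Node g c))) (series b) n.
    by apply: eq_conv => // m; rewrite (eq_trunc aE) trunc_shift.
  have [cL|cL] := LeafVnode c.
    subst c; apply: (@ContractSame _ _ (Node g b)) => [//||n].
      by rewrite /= sz /= addn0.
    by rewrite E seriesN //; apply: eq_conv => // m; rewrite -shift_succ.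
  apply: (@ContractShift _ _ (Node (Node g c) b)) => [//||n].
    by rewrite /= sz.
  rewrite E conv_shiftl; apply: eq_shift => m; rewrite seriesN //.
  by apply: eq_conv => // k; rewrite trunc_id // seriesN // conv_trunc_0.
case: (IHb (i - spines a)) => [//|b1 bE|bE|b' b'L sz bE|b' b'L sz bE].
- apply: (@ContractShift _ _ (Node a Leaf)) => [//||n].
    by rewrite /= b1 addn0 addn1.
  by rewrite (eq_conv (frefl _) bE) conv_delta0 -shift_succ.
- by apply: ContractZero; apply: conv_0r.
- apply: (@ContractSame _ _ (Node a b')) => [//||n].
    by rewrite /= sz !addnS.
  by rewrite seriesN //; apply: eq_conv.
apply: (@ContractShift _ _ (Node a b')) => [//||n].
  by rewrite /= sz !addnS.
rewrite (eq_conv (frefl _) bE) conv_shiftr; apply: eq_shift => m.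
by rewrite seriesN.
Qed.

(** * Lower bound for trees without forced exponent *)

(** The two parts correspond to q_i = 1 and q_i >= 2.  The case q_i = 0 never
    arises, except in an empty tree: the first node of a chain truncates or
    divides by x, and both discard the constant term. *)
Lemma series_at_split t i n : i < spines t -> 0 < n \/ t <> Leaf ->
  series t n = series_at delta1 t i n + series_at catalan_ge2 t i n.
Proof.
elim: t i n => [|a IHa b IHb] i n.
  by case: n => [|[|n]] // _; [case | rewrite /= catalan1].
have [bL|bL] := LeafVnode b.
  by subst b => /= iL _; apply: IHa => //; left.
rewrite spinesN // !series_atN // seriesN // => iL _; case: ltnP => ia.
  rewrite -convDl; apply: eq_conv => // -[|m] //=.
  by apply: IHa => //; left.
rewrite -convDr; apply: eq_conv => // m; apply: IHb; last by right.
by rewrite ltn_subLR.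
Qed.

Lemma conv_gt0 f g n : 0 < conv f g n ->
  exists2 i, i <= n & 0 < f i * g (n - i).
Proof.
rewrite lt0n sum_nat_eq0 negb_forall => /existsP[i]; rewrite /= -lt0n => fg.
by exists (i : nat); rewrite // -ltnS.
Qed.

(** With n + r - s as the excess sum (q_i - 1), this says that f n is 0 or at
    least 2 to the excess, without subtraction. *)
Definition exp2_bounded (t : tree) (f : nat -> nat) : Prop :=
  forall n, 0 < f n -> 2 ^ (n + rightless t) <= 2 ^ spines t * f n.

Lemma exp2_bounded_conv a b f g : b <> Leaf ->
  exp2_bounded a f -> exp2_bounded b g ->
  exp2_bounded (Node a b) (conv (trunc f) g).
Proof.
move=> bL fB gB n /conv_gt0[[|i]] // iN.
rewrite muln_gt0 => /andP[/fB fi /gB gi].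
rewrite spinesN // rightlessN //.
rewrite -{1}(subnKC iN) addnACA (expnD _ (i.+1 + _)) (expnD _ (spines a)).
apply: leq_trans (leq_mul fi gi) _; rewrite mulnACA leq_mul2l.
have iN' : i.+1 < n.+1 by [].
by rewrite /conv (bigD1 (Ordinal iN')) //= leq_addr orbT.
Qed.

Lemma exp2_bounded_series t : exp2_bounded t (series t).
Proof.
elim: t => [|a IHa b IHb]; first by move=> n _; rewrite addn0 leq_exp2_catalan.
have [bL|bL] := LeafVnode b.
  by subst b => n /= /IHa; rewrite addSnnS.
by move=> n; rewrite seriesN //; apply: exp2_bounded_conv.
Qed.

Lemma exp2_bounded_series_at t i : exp2_bounded t (series_at catalan_ge2 t i).
Proof.
elim: t i => [|a IHa b IHb] i.
  move=> n /=; rewrite /catalan_ge2; case: ifP => // _ _.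
  by rewrite addn0 leq_exp2_catalan.
have [bL|bL] := LeafVnode b.
  by subst b => n /= /IHa; rewrite addSnnS.
case: (ltnP i (spines a)) => ia n.
  rewrite series_atN // ia.
  by apply: exp2_bounded_conv => //; apply: exp2_bounded_series.
rewrite series_atN // (ltnNge i) ia.
by apply: exp2_bounded_conv => //; apply: exp2_bounded_series.
Qed.

(** In a tuple, the number of i with q_i >= 2 is at most
    sum (q_i - 1) = n + r - s.  The bound is the weighted sum of this
    inequality over the tuples. *)
Lemma sum_series_at t n : 0 < n \/ t <> Leaf ->
  \sum_(i < spines t) series_at catalan_ge2 t i n + spines t * series t n <=
  (n + rightless t) * series t n.
Proof.
elim: t n => [|a IHa b IHb] n.
  case: n => [[]//|n] _; rewrite big_ord1 /= addn0 mul1n /catalan_ge2.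
  case: n => [|n]; first by rewrite mul1n.
  by rewrite -[_ + _]/(catalan n.+2 + catalan n.+2) addnn -mul2n leq_mul2r orbT.
have [bL|bL] := LeafVnode b.
  subst b => _ /=; rewrite -addSnnS; apply: IHa; by left.
move=> _; rewrite spinesN // rightlessN //.
rewrite seriesN // big_split_ord.
have -> : \sum_(i < spines a) series_at catalan_ge2 (Node a b) i n =
    conv (fun m => \sum_(i < spines a) trunc (series_at catalan_ge2 a i) m)
      (series b) n.
  rewrite (conv_suml _ (fun i => trunc (series_at catalan_ge2 a i))).
  by apply: eq_bigr => i _; rewrite series_atN //= ltn_ord.
have -> :
    \sum_(i < spines b) series_at catalan_ge2 (Node a b) (spines a + i) n =
    conv (trunc (series a))
      (fun m => \sum_(i < spines b) series_at catalan_ge2 b i m) n.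
  rewrite (conv_sumr _ _ (series_at catalan_ge2 b)).
  by apply: eq_bigr => i _; rewrite series_atN //= ltnNge leq_addr addKn.
rewrite /conv !big_distrr /= -!big_split /=; apply: leq_sum => /= -[i iN] _ /=.
case: i iN => [|i] iN; first by rewrite /= !muln0 big1.
have := IHa i.+1 (or_introl isT); have := IHb (n - i.+1) (or_intror bL).
rewrite /=; move: (\sum_(j < _) _) (\sum_(j < _) _) => sb sa hb ha.
have -> : n + (rightless a + rightless b) =
    (i.+1 + rightless a) + (n - i.+1 + rightless b) by lia.
move: (series a _) (series b _) (i.+1 + _) (n - _ + _) hb ha => fa fb ka kb.
move=> /(leq_mul (leqnn fa)) hb /leq_mul/(_ (leqnn fb)) ha.
by apply: leq_trans (leq_trans (leq_add ha hb) _); lia.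
Qed.

Lemma leq_double_exp2 e : 0 < e -> 2 * e <= 2 ^ e.
Proof. by case: e => // e _; rewrite expnS leq_pmul2l // ltn_expl. Qed.

Lemma ltn_exp2_sqr e : e * e < 2 ^ e + e.
Proof.
case: e => [|[|[|[|e]]]] //; elim: e => [//|e IHe].
rewrite expnS; move: IHe; move: (2 ^ _) => k; nia.
Qed.

(** With s chains and excess e, the tree has 2 s + e - 1 nodes. *)
Lemma size_bound t : 0 < series t 0 ->
  (forall i, i < spines t -> 0 < series_at catalan_ge2 t i 0) -> t <> Leaf ->
  tree_size t <= series t 0 + 1.
Proof.
move=> f0 K0 tL; have := sum_series_at (n := 0) (or_intror tL).
have szE := tree_sizeE t; have sp0 := spines_gt0 t.
rewrite add0n; set S := \sum_(_ < _) _; move=> SB.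
have SE : spines t * 2 ^ rightless t <= 2 ^ spines t * S.
  rewrite /S big_distrr -[X in X * _]card_ord -sum_nat_const /=.
  by apply: leq_sum => i _; apply: exp2_bounded_series_at; apply: K0.
move: (series t 0) (spines t) (rightless t) (tree_size t) f0 sp0 szE SB SE.
move=> f s d z f0 s0 zE SB SE.
(* e is the excess r - s; it is nonnegative because f > 0. *)
have [e dE] : exists e, d = s + e.
  exists (d - s); rewrite subnKC // -(leq_pmul2r f0).
  exact: leq_trans (leq_addl _ _) SB.
have eB : s * 2 ^ e <= e * f.
  move: SE SB; rewrite dE expnD mulnCA leq_pmul2l ?expn_gt0 // mulnDl.
  by rewrite addnC leq_add2l; apply: leq_trans.
have e0 : 0 < e by case: e eB {dE} => //; rewrite muln1 mul0n; lia.
(* If f <= 2 s + e - 3, then s (2^e - 2 e) <= e (e - 3).  As s >= 1 and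
   2^e >= 2 e, this implies 2^e <= e (e - 1). *)
rewrite leqNgt; apply/negP => zf.
have e2 := ltn_exp2_sqr e; have e3 := leq_double_exp2 e0.
nia.
Qed.

Theorem theorem3p5 (f : nat) (f_gt0 : 0 < f) (fert_f : fertility_number f) :
  exists n : nat, exists p : seq nat,
    [/\ 0 < n, n <= f + 1, in_S n p & f = fertility p].
Proof.
suff [t [t0 tf tE]] : exists t,
    [/\ 0 < tree_size t, tree_size t <= f + 1 & series t 0 = f].
  exists (tree_size t), (tree_word 0 t); split=> //.
    exact: perm_tree_word.
  by rewrite fertility_tree_word.
have [t tE] : exists t, series t 0 = f.
  case: fert_f => p /andP[pU _] <-; exists (shape p).
  by rewrite fertility_series.
elim: {t}(tree_size t) {-2}t (leqnn (tree_size t)) tE => [|N IHN] t tN tE.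
  exists (Node Leaf Leaf); split=> //; first by rewrite addn1 ltnS.
  by case: t tE tN => //= <- _; apply: catalan1.
have [tL|tL] := LeafVnode t.
  by apply: (IHN t) => //; rewrite tL.
case: (boolP [forall i : 'I_(spines t), 0 < series_at catalan_ge2 t i 0])
  => [/forallP K0|].
  exists t; split=> //; first by case: (t) tL.
  rewrite -tE; apply: size_bound => //; first by rewrite tE.
  by move=> i iN; apply: (K0 (Ordinal iN)).
rewrite negb_forall => /existsP[i]; rewrite -eqn0Ngt => /eqP Ki.
have fE : series_at delta1 t i 0 = f.
  by rewrite -tE (@series_at_split t i 0) ?Ki ?addn0 //; right.
case: (contract t i) fE => [//|t1 E|E|t' t'L sz E|t' t'L sz E]; rewrite E => fE.
- exists t; rewrite t1; split=> //; first by rewrite leq_addl.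
- by move: f_gt0; rewrite -fE.
- by apply: (IHN t') => //; lia.
by move: f_gt0; rewrite -fE.
Qed.
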